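(* Let $q$ be a prime power, $n\ge 1$, $b_0,\dots,b_{n-1}\in\mathbb{F}_{q^n}$ and $\xi\in\mathbb{F}_{q^n}^*$. Define $B(x,y)=\mathrm{Tr}_{q^n/q}\bigl(\sum_{i=0}^{n-1}b_i x y^{q^i}\bigr)$ for $x,y\in\mathbb{F}_{q^n}$ and $x*y:=xy+B(x,y)\xi$. Let $M(X):=\xi\sum_{i=0}^{n-1}b_iX^{q^i}$. Then $(\mathbb{F}_{q^n},+,* )$ is a presemifield if and only if $\mathrm{Tr}_{q^n/q}(M(a)/a)\neq -1$ for every $a\in\mathbb{F}_{q^n}^*$.
   Context: $\mathrm{Tr}_{q^n/q}$ denotes the trace map from $\mathbb{F}_{q^n}$ to $\mathbb{F}_q$. A presemifield is a set with two operations $+,*$ such that $(\mathbb{S},+)$ is a group with identity $0$, both distributive laws hold, $0*a=a*0=0$ for all $a$, and $(\mathbb{S}\setminus\{0\},* )$ is a quasigroup (for finite $\mathbb{S}$ with distributive laws this is equivalent to: $x*y=0$ implies $x=0$ or $y=0$); no multiplicative identity is required. *)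

(* Defs.v *)
From HB Require Import structures.
From mathcomp Require Import all_boot all_order all_algebra all_fingroup.
From mathcomp Require Import all_solvable all_field.

Set Implicit Arguments.
Unset Strict Implicit.
Unset Printing Implicit Defensive.

Import GRing.Theory.

Definition is_group (S : Type) (e : S) (op : S -> S -> S) : Prop :=
  [/\ associative op, left_id e op, right_id e op
    & forall x, exists y, op y x = e /\ op x y = e].

(* The subset D of S is a quasigroup under op: op restricts to a binary
   operation on D for which left and right division in D are uniquely
   possible. *)
Definition is_quasigroup_on (S : Type) (D : S -> Prop) (op : S -> S -> S) :
    Prop :=
  [/\ forall a b, D a -> D b -> D (op a b),
      forall a b, D a -> D b -> exists! x, D x /\ op a x = b
    & forall a b, D a -> D b -> exists! y, D y /\ op y a = b].

(* (S, +) is only required to be a group; commutativity is not assumed. *)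
Record is_presemifield (S : Type) (zero : S) (add mul : S -> S -> S) : Prop :=
  IsPresemifield {
    presemifield_group : is_group zero add;
    presemifield_mulDl : left_distributive mul add;
    presemifield_mulDr : right_distributive mul add;
    presemifield_mul0 : left_zero zero mul;
    presemifield_mulr0 : right_zero zero mul;
    presemifield_quasigroup : is_quasigroup_on (fun x => x <> zero) mul
  }.

Local Open Scope ring_scope.

(* L is a finite extension of the finite field F. Every such extension is a
   splitting field, so asking for splittingFieldType (which galTrace needs) is
   no restriction. F is identified with the subfield 1 of L, hence the trace
   from L to F takes its values in L. *)
Definition Tr (F : finFieldType) (L : splittingFieldType F) (x : L) : L :=
  galTrace 1 {:L} x.

Definition formB (F : finFieldType) (L : splittingFieldType F) (q n : nat)
    (b : 'I_n -> L) (x y : L) : L :=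
  Tr (\sum_(i < n) b i * x * y ^+ (q ^ i)).

Definition mulB (F : finFieldType) (L : splittingFieldType F) (q n : nat)
    (b : 'I_n -> L) (xi : L) (x y : L) : L :=
  x * y + formB q b x y * xi.

Definition polyM (F : finFieldType) (L : splittingFieldType F) (q n : nat)
    (b : 'I_n -> L) (xi : L) : {poly L} :=
  xi *: \sum_(i < n) b i *: 'X^(q ^ i).

(* Main.v *)
Require Import Defs.
From HB Require Import structures.
From mathcomp Require Import all_boot all_order all_algebra all_fingroup.
From mathcomp Require Import all_solvable all_field.

(** If [x * a = 0] with [x, a] nonzero, then [x = c xi / a] with
    [c = - B(x, a)] a nonzero scalar of the base field; since
    [B(c xi / a, a) = c Tr(M(a) / a)], this forces [Tr(M(a) / a) = -1].
    Conversely, if [Tr(M(a) / a) = -1], then [(xi / a) * a = 0].  Hence the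
    trace condition says that [*] has no zero divisors, which for a biadditive
    product on a finite group is the presemifield property. *)

Import GRing.Theory.
Local Open Scope ring_scope.

(** Without zero divisors, left and right multiplications by a nonzero element are additive with
    trivial kernel, hence injective, and finiteness makes them onto. This gives the unique divisions
    of a quasigroup. *)
Lemma presemifield_zero_divisorP (V : finZmodType) (mul : V -> V -> V) :
    left_distributive mul +%R -> right_distributive mul +%R ->
  is_presemifield 0 +%R mul <->
  (forall x y, x != 0 -> y != 0 -> mul x y != 0).
Proof.
move=> mulDl mulDr.
have mul0 x : mul 0 x = 0 by apply: (addIr (mul 0 x)); rewrite -mulDl !add0r.
have mulr0 x : mul x 0 = 0 by apply: (addIr (mul x 0)); rewrite -mulDr !add0r.
have mulBl x y z : mul (x - y) z = mul x z - mul y z.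
  by apply: (addIr (mul y z)); rewrite -mulDl !subrK.
have mulBr x y z : mul x (y - z) = mul x y - mul x z.
  by apply: (addIr (mul x z)); rewrite -mulDr !subrK.
split=> [[_ _ _ _ _ [nz _ _]] x y /eqP x0 /eqP y0|nz].
  by apply/eqP; apply: nz.
have injr a : a != 0 -> injective (mul a).
  move=> a0 x y /eqP; rewrite -subr_eq0 -mulBr => /eqP axy.
  by have [/subr0_eq //|/(nz _ _ a0)] := eqVneq (x - y) 0; rewrite axy eqxx.
have injl a : a != 0 -> injective (mul^~ a).
  move=> a0 x y /eqP; rewrite -subr_eq0 -mulBl => /eqP axy.
  by have [/subr0_eq //|/nz/(_ a0)] := eqVneq (x - y) 0; rewrite axy eqxx.
split=> //; first split; first exact: addrA; first exact: add0r.
- exact: addr0.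
- by move=> x; exists (- x); rewrite addNr subrr.
split=> [a b /eqP a0 /eqP b0|a b /eqP a0 b0|a b /eqP a0 b0].
- by apply/eqP; apply: nz.
- have /codomP[x bE] := injF_onto (injr a a0) b.
  exists x; split=> [|y [_ yE]]; last by apply: (injr a a0); rewrite yE.
  by split=> // x0; apply: b0; rewrite bE x0.
- have /codomP[x bE] := injF_onto (injl a a0) b.
  exists x; split=> [|y [_ yE]]; last by apply: (injl a a0); rewrite yE.
  by split=> // x0; apply: b0; rewrite bE x0.
Qed.

Section TraceForm.

Variables (F : finFieldType) (L : splittingFieldType F).
Implicit Types x y z : L.

(** [#|F|] is a power of the characteristic, which [L] shares with [F], so this is an iterated
    Frobenius map. *)
Lemma exprDn_card_pow x y i :
  (x + y) ^+ (#|F| ^ i) = x ^+ (#|F| ^ i) + y ^+ (#|F| ^ i).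
Proof.
apply: exprDn_pchar; have [p p_pr pcharFp] := finPcharP F.
rewrite (card_pprimeChar pcharFp) -expnM pnatX pnatE //.
by rewrite (pchar_lalg L) pcharFp.
Qed.

Lemma TrD x y : Tr (x + y) = Tr x + Tr y.
Proof. exact: raddfD. Qed.

(** Every Galois automorphism fixes [Tr x], which therefore factors out of the sum of conjugates. *)
Lemma TrMTr x y : Tr (Tr x * y) = Tr x * Tr y.
Proof.
(* Only the outer trace and [Tr y] are expanded; [Tr x] stays folded, to be fixed by each [s]. *)
rewrite {1 4}/Tr /galTrace mulr_sumr; apply: eq_bigr => s sG; rewrite rmorphM.
have /mem_fixedFieldP[_ /(_ s sG) sTr] := galTrace_fixedField 1 (memvf x).
by rewrite /= [s (Tr x)]sTr.
Qed.

Variables (n : nat) (b : 'I_n -> L) (xi : L).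
Local Notation q := #|F|.

Lemma formBE x y :
  Defs.formB q b x y = Tr (x * \sum_(i < n) b i * y ^+ (q ^ i)).
Proof.
rewrite /Defs.formB mulr_sumr; congr Tr; apply: eq_bigr => i _.
by rewrite mulrCA mulrA.
Qed.

Lemma formBNl x y : Defs.formB q b (- x) y = - Defs.formB q b x y.
Proof. by rewrite !formBE mulNr [LHS]raddfN. Qed.

(** Values of the form are traces, hence base field scalars, and the form is linear over the base
    field in its first argument. *)
Lemma formB_scalel x y z w :
  Defs.formB q b (Defs.formB q b x y * z) w
  = Defs.formB q b x y * Defs.formB q b z w.
Proof. by rewrite 2![Defs.formB _ _ _ w]formBE -mulrA TrMTr. Qed.

Lemma horner_polyM y :
  (polyM q b xi).[y] = xi * \sum_(i < n) b i * y ^+ (q ^ i).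
Proof.
rewrite hornerZ horner_sum; congr (_ * _).
by apply: eq_bigr => i _; rewrite hornerZ hornerXn.
Qed.

Lemma mulB_mulDl : left_distributive (mulB q b xi) +%R.
Proof. by move=> x y z; rewrite /mulB !formBE !mulrDl TrD mulrDl addrACA. Qed.

Lemma mulB_mulDr : right_distributive (mulB q b xi) +%R.
Proof.
move=> x y z; rewrite /mulB !formBE addrACA -mulrDr -mulrDl -TrD -mulrDr.
rewrite -big_split /=; congr (_ + Tr (_ * _) * _).
by apply: eq_bigr => i _; rewrite exprDn_card_pow mulrDr.
Qed.

Lemma formB_div a : Defs.formB q b (xi / a) a = Tr ((polyM q b xi).[a] / a).
Proof. by rewrite formBE horner_polyM mulrAC. Qed.

Lemma mulB_neq0P : xi != 0 ->
  (forall x y, x != 0 -> y != 0 -> mulB q b xi x y != 0) <->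
  (forall a, a != 0 -> Tr ((polyM q b xi).[a] / a) != -1).
Proof.
move=> xi0; split=> [nz a a0 | trN1 x a x0 a0].
  apply: contraNneq (nz (xi / a) a _ a0) => [TrE|].
    by rewrite /mulB formB_div TrE divfK // mulN1r subrr.
  by rewrite mulf_neq0 ?invr_neq0.
apply: contraNneq (trN1 a a0) => /eqP; rewrite addr_eq0 => /eqP xaE.
have xE : x = - (Defs.formB q b x a * (xi / a)).
  by rewrite mulrA -mulNr -xaE mulfK.
have B0 : Defs.formB q b x a != 0.
  by apply: contraNneq x0 => B0; rewrite xE B0 mul0r oppr0.
(* Only the left-hand [x] is replaced by its expression in [xi / a]. The scalar $B(x,a)$ then
   appears on both sides and, being nonzero, cancels. *)
have BE : Defs.formB q b x a
    = - (Defs.formB q b x a * Tr ((polyM q b xi).[a] / a)).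
  by rewrite {1}xE formBNl formB_scalel formB_div.
by rewrite -(inj_eq (mulfI B0)) mulrN1 -eqr_oppLR -BE.
Qed.

End TraceForm.

Theorem theorem2p1 (q n : nat) (F : finFieldType) (L : splittingFieldType F)
    (hq : #|F| = q) (hn : \dim {:L} = n)
    (b : 'I_n -> L) (xi : L) (hxi : xi != 0) :
  is_presemifield (0 : L) +%R (mulB q b xi) <->
  (forall a : L, a != 0 -> Tr ((polyM q b xi).[a] / a) != -1).
Proof.
rewrite -{q}hq; apply: iff_trans (mulB_neq0P F L n b xi hxi).
(* [finvect_type L] is [L] with the finite structure it has as a finite-dimensional space over
   [F]. *)
exact: (presemifield_zero_divisorP (finvect_type L) _
          (mulB_mulDl F L n b xi) (mulB_mulDr F L n b xi)).
Qed.
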